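(* For every convergent $\{x,y\}$-decorated rooted forest $F$, the shuffle arborified zeta value $\zeta^T_{\mathrm{sh}}(F)$ is a $\mathbb{Q}$-linear combination of multiple zeta values $\zeta_{\mathrm{sh}}(w)$ ($w$ convergent words in the alphabet $\{x,y\}$), and it can be written as a finite linear combination of multiple zeta values with integer coefficients. Furthermore the map $\zeta^T_{\mathrm{sh}}:\mathcal{F}^{\mathrm{conv}}_{\{x,y\}}\to\mathbb{R}$ is an algebra morphism for the concatenation product of trees.
   Context: A rooted forest is a finite (possibly empty) disjoint union of finite (non-planar) rooted trees; an $\Omega$-decorated forest carries a map from its vertex set to $\Omega$; forests are taken up to isomorphism. $\mathcal{F}_\Omega$ is the commutative unital $\mathbb{R}$-algebra freely generated by nonempty $\Omega$-decorated rooted trees: product is concatenation (disjoint union), unit is the empty forest $\emptyset$, forests form a basis. $B_+^\omega(F)$ is the tree obtained from $F$ by adding a new root decorated by $\omega$ joined to every root of $F$. A leaf is a vertex without direct successor (child); a branching vertex is a vertex with strictly more than one direct successor. A forest in $\mathcal{F}_{\{x,y\}}$ is semiconvergent if all its leaves and branching vertices are decorated by $y$, and convergent if moreover all its roots are decorated by $x$ (the empty forest is convergent). $\mathcal{F}^{\mathrm{conv}}_{\{x,y\}}$ is the linear span of convergent forests, a subalgebra of $\mathcal{F}_{\{x,y\}}$. A word in $\{x,y\}$ is convergent if it is empty, or if it starts with $x$ and ends with $y$. Let $\sigma_x(t)=1/t$, $\sigma_y(t)=1/(1-t)$. For $0<\epsilon<1$ define functions $A_\epsilon(F)$ on $[\epsilon,1[$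 by $A_\epsilon(\emptyset)=1$, $A_\epsilon(F_1F_2)=A_\epsilon(F_1)A_\epsilon(F_2)$, $A_\epsilon(B_+^{\omega}(F))(z)=\int_\epsilon^z\sigma_\omega(t)A_\epsilon(F)(t)\,dt$. For semiconvergent $F$ and $z\in]0,1[$ set $Li^T_F(z)=\lim_{\epsilon\to0^+}A_\epsilon(F)(z)$ (the limit exists). For convergent $F$, $\zeta^T_{\mathrm{sh}}(F)=\lim_{z\to1^-}Li^T_F(z)$ (the limit exists), extended linearly. For a convergent word $w=(\omega_1\cdots\omega_k)$, $\zeta_{\mathrm{sh}}(w)=\zeta^T_{\mathrm{sh}}\big(B_+^{\omega_1}\circ\cdots\circ B_+^{\omega_k}(\emptyset)\big)$, i.e. $\zeta_{\mathrm{sh}}(w)=\int_{1\ge t_1\ge\cdots\ge t_k\ge0}\prod_i\sigma_{\omega_i}(t_i)dt_i$, with $\zeta_{\mathrm{sh}}(\emptyset)=1$. *)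

(* Defs.v *)
From HB Require Import structures.
From mathcomp Require Import all_boot all_order all_algebra finmap.
From mathcomp Require Import generic_quotient.
From mathcomp.multinomials Require Import monalg.
From mathcomp Require Import all_classical all_reals all_analysis.

Set Implicit Arguments.
Unset Strict Implicit.
Unset Printing Implicit Defensive.

Import Order.TTheory GRing.Theory Num.Theory.
Import numFieldTopology.Exports numFieldNormedType.Exports.

Local Open Scope classical_set_scope.
Local Open Scope ring_scope.
Local Open Scope quotient_scope.

(* Planar trees (ordered children); the trees that matter are their
   isomorphism classes [rtree] below. *)
Inductive ptree (Om : Type) : Type := PNode of Om & seq (ptree Om).

HB.instance Definition _ (Om : Type) := gen_eqMixin (ptree Om).
HB.instance Definition _ (Om : Type) := gen_choiceMixin (ptree Om).

(* Isomorphism of the underlying non-planar decorated rooted trees: the roots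
   have the same decoration, and the subtrees hanging from them are matched by
   a bijection [f] with isomorphic ones. *)
Inductive tree_iso (Om : Type) : ptree Om -> ptree Om -> Prop :=
  TreeIso (a : Om) (s s' : seq (ptree Om)) (f : 'I_(size s) -> 'I_(size s')) of
      bijective f
    & (forall i, tree_iso (tnth (in_tuple s) i) (tnth (in_tuple s') (f i))) :
    tree_iso (PNode a s) (PNode a s').

Fixpoint ptree_nested_ind (Om : Type) (P : ptree Om -> Prop)
    (H : forall a s, (forall i, P (tnth (in_tuple s) i)) -> P (PNode a s))
    (t : ptree Om) : P t.
Proof.
case: t => a s; apply: (H).
elim: s => [|u s IHs] [[|i] Hi] //; rewrite (tnth_nth u) /=.
  exact: (ptree_nested_ind _ P H).
by have := IHs (Ordinal (Hi : (i < size s)%N)); rewrite (tnth_nth u).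
Qed.

Lemma tree_iso_refl (Om : Type) (t : ptree Om) : tree_iso t t.
Proof.
elim/ptree_nested_ind: t => a s IH.
by apply: (TreeIso a (Bijective (frefl id) (frefl id))) => i; exact: IH.
Qed.

Lemma tree_iso_sym (Om : Type) (t u : ptree Om) : tree_iso t u -> tree_iso u t.
Proof.
elim=> a s s' f [g fK gK] _ IH.
apply: (TreeIso a (Bijective gK fK)) => i.
by have := IH (g i); rewrite gK.
Qed.

Lemma tree_iso_trans (Om : Type) (t u v : ptree Om) :
  tree_iso t u -> tree_iso u v -> tree_iso t v.
Proof.
move=> tu; elim: tu v => a s s' f bf _ IH v.
move E : (PNode a s') => w wv; case: wv E => b s1 s2 g bg Hg [eb es].
subst b s1.
apply: (TreeIso a (bij_comp bg bf)) => i.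
by apply: IH; apply: Hg.
Qed.

Definition tree_equiv (Om : Type) : rel (ptree Om) :=
  fun t u => `[< tree_iso t u >].

Lemma tree_equiv_class (Om : Type) : equiv_class_of (@tree_equiv Om).
Proof.
split=> [t|t u|t u v]; first by apply/asboolP; exact: tree_iso_refl.
  by apply/asboolP/asboolP; exact: tree_iso_sym.
by move=> /asboolP ut /asboolP tv; apply/asboolP; exact: tree_iso_trans ut tv.
Qed.

Canonical tree_equiv_rel (Om : Type) := EquivRelPack (tree_equiv_class Om).

Definition rtree (Om : Type) := {eq_quot (@tree_equiv_rel Om)}.

HB.instance Definition _ (Om : Type) := EqQuotient.on (rtree Om).
HB.instance Definition _ (Om : Type) := Choice.on (rtree Om).

Lemma repr_pi_iso (Om : Type) (t : ptree Om) :
  tree_iso (repr (\pi_(rtree Om) t)) t.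
Proof. by apply/asboolP/(@eqmodP _ (@tree_equiv_rel Om)); rewrite reprK. Qed.

(* Forests up to isomorphism are finite multisets of trees: [F t] is the number
   of components of [F] isomorphic to [t].  [mmul] is disjoint union, [mone] the
   empty forest. *)
Definition forest (Om : Type) := {cmonom (rtree Om)}.

HB.instance Definition _ (Om : Type) := ConomialDef.on (forest Om).

Definition components (Om : Type) (F : forest Om) : seq (rtree Om) :=
  flatten [seq nseq (F t) t | t <- finsupp F].

Definition Bplus (Om : Type) (a : Om) (F : forest Om) : rtree Om :=
  \pi_(rtree Om) (PNode a [seq repr t | t <- components F]).

Definition tree_forest (Om : Type) (t : rtree Om) : forest Om := ucm t.

(* The free commutative R-algebra on the nonempty trees; its basis [<< F >>]
   is indexed by the forests. *)
Definition forest_alg (R : realType) (Om : Type) := {malg R[forest Om]}.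

HB.instance Definition _ (R : realType) (Om : Type) :=
  GRing.ComAlgebra.on (forest_alg R Om).

Variant letter := lx | ly.

HB.instance Definition _ := gen_eqMixin letter.
HB.instance Definition _ := gen_choiceMixin letter.

(* Every vertex, given by its decoration and its number of children. *)
Fixpoint vertices (Om : Type) (t : ptree Om) : seq (Om * nat) :=
  let: PNode a s := t in
  (a, size s) :: flatten (map (@vertices Om) s).

Definition root_decoration (Om : Type) (t : ptree Om) : Om := let: PNode a _ := t in a.

Definition is_leaf (Om : Type) (v : Om * nat) : bool := v.2 == 0%N.

Definition is_branching (Om : Type) (v : Om * nat) : bool := (1 < v.2)%N.

Definition semiconvergent (F : forest letter) : bool :=
  all (fun t : rtree letter =>
         all (fun v => (is_leaf v || is_branching v) ==> (v.1 == ly))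
             (vertices (repr t)))
      (components F).

Definition convergent (F : forest letter) : bool :=
  semiconvergent F &&
  all (fun t : rtree letter => root_decoration (repr t) == lx) (components F).

Definition convergent_word (w : seq letter) : bool :=
  (w == [::]) || ((head ly w == lx) && (last lx w == ly)).

Definition conv_span (R : realType) : {pred forest_alg R letter} :=
  fun u => `[< exists2 s : seq (R * forest letter),
                 all convergent (map snd s) &
                 u = \sum_(p <- s) p.1 *: << p.2 >> >].

Lemma count_components (Om : Type) (F : forest Om) (t : rtree Om) :
  count_mem t (components F) = F t.
Proof.
rewrite count_flatten -map_comp sumnE big_map.
under eq_bigr => u _ do rewrite /= count_nseq /=.
have [tF|tF] := boolP (t \in finsupp F).
  rewrite (bigD1_seq t) ?fset_uniq//= eqxx mul1n big1 ?addn0// => u ut.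
  by rewrite (negbTE ut) mul0n.
rewrite big_seq big1 => [|u uF]; last first.
  have /negbTE-> : u != t by apply: contraNneq tF => <-.
  by rewrite mul0n.
by apply/esym/eqP; rewrite cmE_eq0.
Qed.

Lemma components_mul (Om : Type) (F G : forest Om) :
  perm_eq (components (mmul F G)) (components F ++ components G).
Proof.
apply/allP => t _ /=; apply/eqP.
by rewrite count_cat !count_components cmM.
Qed.

Lemma components_empty (Om : Type) : components (mone : forest Om) = [::].
Proof.
case E : (components _) => [//|t s].
by have := count_components (mone : forest Om) t; rewrite E/= eqxx cm1.
Qed.

Lemma components_tree (Om : Type) (t : rtree Om) :
  components (tree_forest t) = [:: t].
Proof.
apply/perm_small_eq => //; apply/allP => u _ /=.
by rewrite count_components cmU addn0.
Qed.

Lemma convergent_empty : convergent mone.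
Proof. by rewrite /convergent /semiconvergent components_empty. Qed.

Lemma convergent_mul (F G : forest letter) :
  convergent (mmul F G) = convergent F && convergent G.
Proof.
rewrite /convergent /semiconvergent !(perm_all _ (components_mul F G)).
by rewrite !all_cat andbACA.
Qed.

Lemma span_subsemialg_closed (R : comNzRingType) (A : algType R)
    (K : monomType) (P : pred K) (b : K -> A) :
    P mone -> (forall k l, P k -> P l -> P (mmul k l)) ->
    b mone = 1 -> (forall k l, b (mmul k l) = b k * b l) ->
  GRing.subsemialg_closed (fun u : A =>
    `[< exists2 s : seq (R * K), all P (map snd s) &
          u = \sum_(p <- s) p.1 *: b p.2 >]).
Proof.
move=> P1 PM b1 bM; split.
- apply/asboolP; exists [:: (1, mone)]; first by rewrite /= P1.
  by rewrite big_seq1 scale1r b1.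
- split; first by apply/asboolP; exists [::]; rewrite ?big_nil.
  move=> u v /asboolP[s Ps ->] /asboolP[s' Ps' ->]; apply/asboolP.
  by exists (s ++ s'); rewrite ?big_cat// map_cat all_cat Ps.
- move=> a u /asboolP[s Ps ->]; apply/asboolP.
  exists [seq (a * p.1, p.2) | p <- s]; first by rewrite -map_comp.
  by rewrite big_map scaler_sumr; apply: eq_bigr => p _; rewrite scalerA.
- move=> u v /asboolP[s Ps ->] /asboolP[s' Ps' ->]; apply/asboolP.
  exists [seq (p.1 * q.1, mmul p.2 q.2) | p <- s, q <- s'].
    apply/allP => _ /mapP[_ /allpairsP[[p q] [/= ps qs ->]] ->] /=.
    by apply: PM; [apply: (allP Ps)|apply: (allP Ps')]; apply/map_f.
  rewrite big_allpairs_dep mulr_suml; apply: eq_bigr => p _.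
  rewrite mulr_sumr; apply: eq_bigr => q _ /=.
  by rewrite bM -scalerAl -scalerAr scalerA.
Qed.

Lemma conv_span_subalg (R : realType) : GRing.subsemialg_closed (@conv_span R).
Proof.
apply: (@span_subsemialg_closed R (forest_alg R letter) (forest letter)
  convergent (fun F => << F >>)) => //.
- exact: convergent_empty.
- by move=> F G cF cG; rewrite convergent_mul cF.
- by move=> F G; rewrite /GRing.mul/= fgmulUU mulr1.
Qed.

HB.instance Definition _ (R : realType) :=
  GRing.isSubalgClosed.Build R (forest_alg R letter) (@conv_span R)
    (conv_span_subalg R).

Definition conv_alg (R : realType) : Type :=
  {u : forest_alg R letter | u \in @conv_span R}.

HB.instance Definition _ (R : realType) := [isSub of conv_alg R for sval].
HB.instance Definition _ (R : realType) := [Choice of conv_alg R by <:].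
HB.instance Definition _ (R : realType) :=
  [SubChoice_isSubAlgebra of conv_alg R by <:].
HB.instance Definition _ (R : realType) :=
  [SubNzRing_isSubComNzRing of conv_alg R by <:].

Definition sigma (R : realType) (a : letter) (t : R) : R :=
  match a with lx => t^-1 | ly => (1 - t)^-1 end.

(* Only meaningful for [0 < e <= z < 1].  The [foldr] is the product over the
   children, see [A_treeE]; the values on forests are those prescribed by
   [A_forest_empty], [A_forest_mul] and [A_forest_Bplus]. *)
Fixpoint A_tree (R : realType) (e : R) (t : ptree letter) (z : R) : R :=
  let: PNode a s := t in
  \int[lebesgue_measure]_(u in `[e, z])
    (sigma a u * foldr (fun c p => A_tree e c u * p) 1 s).

Definition A_forest (R : realType) (e : R) (F : forest letter) (z : R) : R :=
  \prod_(t <- components F) A_tree e (repr t) z.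

(* [lim] is a total operator; it is the limit whenever there is one. *)
Definition Li_forest (R : realType) (F : forest letter) (z : R) : R :=
  lim (A_forest e F z @[e --> (0 : R)^'+]).

Definition zeta_forest (R : realType) (F : forest letter) : R :=
  lim (Li_forest F z @[z --> (1 : R)^'-]).

(* The linear extension: [u] is the sum of the [u@_F *: << F >>]. *)
Definition zeta_conv (R : realType) (u : conv_alg R) : R :=
  \sum_(F <- msupp (val u)) (val u)@_F * zeta_forest R F.

Definition ladder (w : seq letter) : forest letter :=
  foldr (fun a F => tree_forest (Bplus a F)) mone w.

Definition zeta_word (R : realType) (w : seq letter) : R :=
  zeta_forest R (ladder w).

Lemma big_tree_iso (T : Type) (U : Type) (idx : U) (op : Monoid.com_law idx)
    (s s' : seq T) (f : 'I_(size s) -> 'I_(size s')) (g : T -> U) :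
    bijective f ->
    (forall i, g (tnth (in_tuple s) i) = g (tnth (in_tuple s') (f i))) ->
  \big[op/idx]_(c <- s) g c = \big[op/idx]_(c <- s') g c.
Proof.
move=> bf fg; rewrite [LHS]big_tnth [RHS]big_tnth [RHS](reindex f) /=; last exact: onW_bij.
by apply: eq_bigr => i _; exact: fg.
Qed.

Lemma vertices_iso (Om : Type) (P : pred (Om * nat)) (t u : ptree Om) :
  tree_iso t u -> count P (vertices t) = count P (vertices u).
Proof.
elim=> a s s' f bf _ IH /=.
have -> : size s = size s' by have := bij_eq_card bf; rewrite !card_ord.
congr (_ + _)%N; rewrite !count_flatten -!map_comp !sumnE !big_map.
exact: (big_tree_iso addn (g := fun c => count P (vertices c)) bf IH).
Qed.

Lemma root_decoration_iso (Om : Type) (t u : ptree Om) :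
  tree_iso t u -> root_decoration t = root_decoration u.
Proof. by case. Qed.

Lemma A_treeE (R : realType) (e : R) (a : letter) (s : seq (ptree letter))
    (z : R) :
  A_tree e (PNode a s) z = \int[lebesgue_measure]_(u in `[e, z])
    (sigma a u * \prod_(c <- s) A_tree e c u).
Proof.
rewrite /=; congr Rintegral; apply/funext => u; congr (_ * _).
by elim: s => [|c s /= ->]; rewrite ?big_nil ?big_cons.
Qed.

Lemma A_tree_iso (R : realType) (e : R) (t u : ptree letter) :
  tree_iso t u -> A_tree e t =1 A_tree e u.
Proof.
elim=> a s s' f bf _ IH z; rewrite !A_treeE; congr Rintegral; apply/funext => v.
congr (_ * _); apply: (big_tree_iso *%R (g := fun c => A_tree e c v) bf) => i.
exact: IH.
Qed.

Lemma A_forest_empty (R : realType) (e z : R) : A_forest e mone z = 1.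
Proof. by rewrite /A_forest components_empty big_nil. Qed.

Lemma A_forest_mul (R : realType) (e : R) (F G : forest letter) (z : R) :
  A_forest e (mmul F G) z = A_forest e F z * A_forest e G z.
Proof. by rewrite /A_forest (perm_big _ (components_mul F G)) big_cat. Qed.

Lemma A_forest_Bplus (R : realType) (e : R) (a : letter) (F : forest letter)
    (z : R) :
  A_forest e (tree_forest (Bplus a F)) z =
  \int[lebesgue_measure]_(t in `[e, z]) (sigma a t * A_forest e F t).
Proof.
rewrite /A_forest components_tree big_seq1 (A_tree_iso e (repr_pi_iso _)).
rewrite A_treeE; congr Rintegral; apply/funext => v.
by rewrite big_map.
Qed.

(* Main.v *)
Require Import Defs.
From mathcomp Require Import all_boot all_order all_algebra finmap.
From mathcomp.multinomials Require Import monalg.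
From mathcomp Require Import all_classical all_reals all_analysis.
From mathcomp Require Import ring lra.

(** Flattening a forest into words turns each arborified integral into a sum of
    iterated integrals. On [e, 1[, a product of two primitives is, by
    integration by parts, the sum of the primitives obtained by keeping either
    outermost integration sign outside ([primitiveM]); by induction, a product
    of two iterated integrals is the sum of the iterated integrals of the
    shuffles of the two words ([A_ladder_shuffle]). Applying this at every
    vertex, from the leaves to the roots, expresses [A_forest e F] as the sum of
    the iterated integrals of the words of [forest_words F], the words that list
    the vertices of F with every parent before its children
    ([A_forest_words]). If F is convergent then so are these words: they start
    at a root of F and end at a leaf ([convergent_words]).

    The identity survives both limits as soon as these limits exist for words.
    For a nonempty word w that ends with y, the iterated integral is at most
    2 ^ |w| * t / sqrt (1 - t), because the derivative of t / sqrt (1 - t)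
    dominates both t / sqrt (1 - t) / t and t / sqrt (1 - t) / (1 - t), up to a
    factor 2 ([A_ladder_le_majorant]). Being monotone in e, it converges when e
    tends to 0. A further integration against 1 / t leaves the integrand
    1 / sqrt (1 - t), which is integrable at 1; hence the words that start with
    x have a bound uniform in z ([A_ladder_x_le]), and monotonicity in z gives
    the second limit.

    So the zeta value of F is the sum of the multiple zeta values of its words,
    with coefficients counting multiplicities. Multiplicativity on
    forests holds before the limits, hence after them ([zeta_forest_mul]), and
    extends bilinearly to the algebra. *)

Set Implicit Arguments.
Unset Strict Implicit.
Unset Printing Implicit Defensive.

Import Order.TTheory GRing.Theory Num.Theory.
Import numFieldTopology.Exports numFieldNormedType.Exports.

Local Open Scope classical_set_scope.
Local Open Scope ring_scope.

(** * Primitives of continuous functions *)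

(** The mean value theorem for G - F. It serves for comparisons of integrals and,
    used in both directions, for equalities of functions with equal
    derivatives. *)
Lemma increment_le_of_derive_le (R : realType) (F G f g : R -> R) (a b : R) :
  a <= b -> {within `[a, b], continuous F} -> {within `[a, b], continuous G} ->
  (forall x, a < x < b -> is_derive x 1 F (f x)) ->
  (forall x, a < x < b -> is_derive x 1 G (g x)) ->
  (forall x, a < x < b -> f x <= g x) ->
  F b - F a <= G b - G a.
Proof.
rewrite le_eqVlt => /predU1P[->|ab] cF cG dF dG fg; first by rewrite !subrr.
have [c cab E] : exists2 c, c \in `]a, b[ &
    (G - F) b - (G - F) a = (g c - f c) * (b - a).
  apply: (@MVT _ (G - F) (fun c => g c - f c)) => //.
    by move=> x; rewrite in_itv/= => xab; apply: is_deriveB; [exact: dG|exact: dF].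
  exact: within_continuousB.
have : 0 <= (G - F) b - (G - F) a.
  by rewrite E mulr_ge0 ?subr_ge0 ?fg ?(ltW ab)//; move: cab; rewrite in_itv.
by rewrite /= !fctE; lra.
Qed.

(** Continuity on [a, 1[, phrased on compact subintervals because these are the
    domains of integration. Continuity at the left endpoint is one-sided: the
    primitives from a vanish to the left of a. *)
Definition continuous_on_co (R : realType) (a : R) (f : R -> R) :=
  forall b, b < 1 -> {within `[a, b], continuous f}.

Section primitive.
Variables (R : realType) (e : R).
Implicit Types f g : R -> R.
Local Notation mu := (@lebesgue_measure R).

Definition primitive f (z : R) := \int[mu]_(u in `[e, z]) f u.

Lemma primitive_start f : primitive f e = 0.
Proof. by rewrite /primitive set_itv1 Rintegral_set1. Qed.

Lemma continuous_on_cst (c : R) : continuous_on_co e (fun=> c).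
Proof. by move=> b _ x; exact: cst_continuous. Qed.

Lemma continuous_on_add f g : continuous_on_co e f -> continuous_on_co e g ->
  continuous_on_co e (fun x => f x + g x).
Proof. by move=> cf cg b b1 x; apply: cvgD; [exact: cf|exact: cg]. Qed.

Lemma continuous_on_mul f g : continuous_on_co e f -> continuous_on_co e g ->
  continuous_on_co e (fun x => f x * g x).
Proof. by move=> cf cg b b1 x; apply: cvgM; [exact: cf|exact: cg]. Qed.

Lemma continuous_on_sum (I : Type) (s : seq I) (F : I -> R -> R) :
  (forall i, continuous_on_co e (F i)) ->
  continuous_on_co e (fun x => \sum_(i <- s) F i x).
Proof.
move=> cF; elim: s => [|i s IH].
  by under eq_fun do rewrite big_nil; exact: continuous_on_cst.
by under eq_fun do rewrite big_cons; exact: continuous_on_add.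
Qed.

Lemma continuous_on_integrable f z : continuous_on_co e f -> z < 1 ->
  mu.-integrable `[e, z] (EFin \o f).
Proof.
move=> cf z1; apply: continuous_compact_integrable; last exact: cf.
exact: segment_compact.
Qed.

Lemma continuous_on_primitive f : continuous_on_co e f ->
  continuous_on_co e (primitive f).
Proof.
move=> cf b b1; have [eb|be] := leP e b.
  by apply: parameterized_integral_continuous => //; exact: continuous_on_integrable.
by rewrite set_itv_ge ?bnd_simp -?ltNge//; exact: continuous_subspace0.
Qed.

Lemma is_derive_primitive f x : continuous_on_co e f -> e < x -> x < 1 ->
  is_derive x 1 (primitive f) (f x).
Proof.
move=> cf ex x1; pose u := (x + 1) / 2.
have xu : x < u by rewrite /u; lra.
have u1 : u < 1 by rewrite /u; lra.
have [||||dF F'] := @continuous_FTC1_closed _ f e x u.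
- exact: xu.
- exact: continuous_on_integrable.
- exact: ex.
- apply: (@within_continuous_continuous _ _ _ e u); [lra|exact: cf|].
  by rewrite in_itv/= ex.
by apply: (DeriveDef dF); rewrite -derive1E; exact: F'.
Qed.

Lemma primitiveD f g z : continuous_on_co e f -> continuous_on_co e g -> z < 1 ->
  primitive (fun x => f x + g x) z = primitive f z + primitive g z.
Proof.
by move=> cf cg z1; apply: RintegralD => //; exact: continuous_on_integrable.
Qed.

Lemma eq_primitive f g z : (forall x, e <= x <= z -> f x = g x) ->
  primitive f z = primitive g z.
Proof.
by move=> fg; apply: eq_Rintegral => x; rewrite inE/= in_itv/=; exact: fg.
Qed.

(** Integration by parts: both sides vanish at e and have the same derivative. *)
Lemma primitiveM f g z : continuous_on_co e f -> continuous_on_co e g ->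
  e <= z < 1 ->
  primitive f z * primitive g z =
  primitive (fun x => f x * primitive g x) z +
  primitive (fun x => g x * primitive f x) z.
Proof.
move=> cf cg /andP[ez z1].
have cF := continuous_on_primitive cf; have cG := continuous_on_primitive cg.
have c1 := continuous_on_mul cf cG; have c2 := continuous_on_mul cg cF.
pose H := (primitive f * primitive g) : R -> R.
pose K := (primitive (fun x => f x * primitive g x) +
  primitive (fun x => g x * primitive f x)) : R -> R.
pose d x := f x * primitive g x + g x * primitive f x.
have cH : {within `[e, z], continuous H} by exact: continuous_on_mul.
have cK : {within `[e, z], continuous K}.
  by apply: continuous_on_add => //; exact: continuous_on_primitive.
have dH x : e < x < z -> is_derive x 1 H (d x).
  move=> /andP[ex xz]; have x1 := lt_trans xz z1.
  have df := is_derive_primitive cf ex x1.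
  have dg := is_derive_primitive cg ex x1.
  have -> : d x = primitive f x *: g x + primitive g x *: f x.
    by rewrite /d addrC mulrC [X in _ + X]mulrC.
  exact: is_deriveM.
have dK x : e < x < z -> is_derive x 1 K (d x).
  move=> /andP[ex xz]; have x1 := lt_trans xz z1.
  by apply: is_deriveD; apply: is_derive_primitive.
have HK := increment_le_of_derive_le ez cH cK dH dK (fun x _ => lexx _).
have KH := increment_le_of_derive_le ez cK cH dK dH (fun x _ => lexx _).
have : H z - H e = K z - K e by apply/eqP; rewrite eq_le HK.
by rewrite /H /K !fctE !primitive_start mul0r addr0 !subr0.
Qed.

End primitive.

(** * Shuffles and the words of a forest *)

Section shuffle.
Variable T : eqType.
Implicit Types (u v w : seq T) (L M : seq (seq T)).

Fixpoint shuffle u : seq T -> seq (seq T) :=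
  match u with
  | [::] => fun v => [:: v]
  | a :: u' => fix shuffle_u v :=
      match v with
      | [::] => [:: u]
      | b :: v' =>
        map (cons a) (shuffle u' v) ++ map (cons b) (shuffle_u v')
      end
  end.

Lemma shuffle_cons a b u v :
  shuffle (a :: u) (b :: v) =
  map (cons a) (shuffle u (b :: v)) ++ map (cons b) (shuffle (a :: u) v).
Proof. by []. Qed.

(** Induction along the interleaving: each step puts back the first letter of w,
    taken from either word. *)
Lemma shuffle_ind (P : seq T -> seq T -> seq T -> Prop) :
  (forall v, P [::] v v) -> (forall u, P u [::] u) ->
  (forall a b u v w, P u (b :: v) w -> P (a :: u) (b :: v) (a :: w)) ->
  (forall a b u v w, P (a :: u) v w -> P (a :: u) (b :: v) (b :: w)) ->
  forall u v w, w \in shuffle u v -> P u v w.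
Proof.
move=> P0v Pu0 Pa Pb; elim=> [|a u IHu].
  by move=> v w; rewrite inE => /eqP->.
elim=> [|b v IHv] w; first by rewrite inE => /eqP->.
rewrite shuffle_cons mem_cat => /orP[] /mapP[w' w'uv ->].
  by apply: Pa; exact: IHu.
by apply: Pb; exact: IHv.
Qed.

Lemma size_shuffle u v w : w \in shuffle u v -> size w = (size u + size v)%N.
Proof.
move: u v w; apply: shuffle_ind => //= [u|a b u v w ->|a b u v w ->] //.
  by rewrite addn0.
by rewrite addnS.
Qed.

Lemma last_shuffle d u v w : w \in shuffle u v ->
  last d w = last d u \/ last d w = last d v.
Proof.
(* The last letter of a :: w is the last letter of w with default a. *)
move=> /(shuffle_ind (P := fun u v w => forall d,
  last d w = last d u \/ last d w = last d v)); apply.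
- by right.
- by left.
- by move=> a b {}u {}v {}w IH {}d /=; exact: IH.
- by move=> a b {}u {}v {}w IH {}d /=; exact: IH.
Qed.

Lemma head_shuffle d u v w : w \in shuffle u v ->
  head d w = head d u \/ head d w = head d v.
Proof.
by move: u v w; apply: shuffle_ind => //=; [right|left|left|right].
Qed.

Definition shuffle_product L M : seq (seq T) :=
  flatten [seq shuffle u v | u <- L, v <- M].

Lemma mem_shuffle_product (P Q S : pred (seq T)) L M :
  (forall u v w, P u -> Q v -> w \in shuffle u v -> S w) ->
  all P L -> all Q M -> all S (shuffle_product L M).
Proof.
move=> PQS /allP PL /allP QM; apply/allP => w.
move=> /flattenP[_ /allpairsP[[u v] [uL vM ->]]]; apply: PQS.
  exact: PL.
exact: QM.
Qed.

End shuffle.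

Section tree_words.
Variable T : eqType.
Implicit Types (t : ptree T) (s : seq (ptree T)) (w : seq T).

Lemma ptree_mem_ind (P : ptree T -> Prop) :
  (forall a s, {in s, forall t, P t} -> P (PNode a s)) -> forall t, P t.
Proof.
move=> PH; elim/ptree_nested_ind => a s IH; apply: PH => t.
by move=> /(tnthP (in_tuple s))[i ->]; exact: IH.
Qed.

(** The linear extensions of the tree order, each read as the word of its
    decorations, with multiplicity. The inner fold is [trees_words], inlined to
    keep the recursion structural. *)
Fixpoint tree_words t : seq (seq T) :=
  let: PNode a s := t in
  map (cons a)
    (foldr (fun c L => shuffle_product (tree_words c) L) [:: [::]] s).

Definition trees_words s : seq (seq T) :=
  foldr (fun c L => shuffle_product (tree_words c) L) [:: [::]] s.

Lemma tree_wordsE a s : tree_words (PNode a s) = map (cons a) (trees_words s).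
Proof. by []. Qed.

Lemma head_tree_words d t : all (fun w => head d w == root_decoration t) (tree_words t).
Proof. by case: t => a s; rewrite tree_wordsE all_map; apply/allP => w _ /=. Qed.

Lemma head_trees_words d s : all (fun t => root_decoration t == d) s ->
  all (fun w => head d w == d) (trees_words s).
Proof.
elim: s => [_|t s IH /= /andP[/eqP td /IH]]; first by rewrite /= eqxx.
move: (head_tree_words d t); rewrite td; apply: mem_shuffle_product.
by move=> u v w /eqP ud /eqP vd /(head_shuffle d)[->|->]; rewrite ?ud ?vd.
Qed.

Lemma size_tree_words t : all (fun w => (0 < size w)%N) (tree_words t).
Proof. by case: t => a s; rewrite tree_wordsE all_map; apply/allP => w _. Qed.

Lemma size_trees_words s : (0 < size s)%N ->
  all (fun w => (0 < size w)%N) (trees_words s).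
Proof.
case: s => // t s _; move: (size_tree_words t) (all_predT (trees_words s)).
apply: mem_shuffle_product => u v w u0 _ /size_shuffle->.
by rewrite addn_gt0 u0.
Qed.

(** With the default d itself, [last d w == d] says that w is empty or ends with
    d, which is stable under shuffles; likewise for [head]. *)
Lemma last_trees_words d s :
  all (fun t => all (fun w => last d w == d) (tree_words t)) s ->
  all (fun w => last d w == d) (trees_words s).
Proof.
elim: s => [_|t s IH /= /andP[td /IH]]; first by rewrite /= eqxx.
move: td; apply: mem_shuffle_product.
by move=> u v w /eqP ud /eqP vd /(last_shuffle d)[->|->]; rewrite ?ud ?vd.
Qed.

(** In a linear extension the last vertex has no children. *)
Lemma last_tree_words d t :
  all (fun v : T * nat => is_leaf v ==> (v.1 == d)) (vertices t) ->
  all (fun w => last d w == d) (tree_words t).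
Proof.
elim/ptree_mem_ind: t => a s IH /= /andP[leaf_a /allP leaf_s].
rewrite all_map -/(trees_words s).
have /last_trees_words/allP last_s :
    all (fun t => all (fun w => last d w == d) (tree_words t)) s.
  apply/allP => t ts; apply: IH => //; apply/allP => v vt; apply: leaf_s.
  by apply/flatten_mapP; exists t.
have [s0|s0] := posnP (size s).
  by rewrite (size0nil s0) /= andbT; move: leaf_a; rewrite /is_leaf/= s0.
have /allP size_s := size_trees_words s0.
apply/allP => w ws /=.
by have := size_s w ws; have := last_s w ws; case: w {ws}.
Qed.

End tree_words.

(** * Iterated integrals and flattening *)

Section A_ladder.
Variable R : realType.
Implicit Types (e z : R) (w : seq letter).

Lemma A_ladder_nil e z : A_forest e (ladder [::]) z = 1.
Proof. exact: A_forest_empty. Qed.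

Lemma A_ladder_cons e a w z : A_forest e (ladder (a :: w)) z =
  primitive e (fun t => sigma a t * A_forest e (ladder w) t) z.
Proof. exact: A_forest_Bplus. Qed.

Lemma continuous_on_sigma e a : 0 < e -> continuous_on_co e (@sigma R a).
Proof.
move=> e0 b b1; apply: continuous_in_subspaceT => x.
rewrite inE/= in_itv/= => /andP[ex xb].
case: a.
  by apply: inv_continuous; rewrite gt_eqF// (lt_le_trans e0).
apply: (@continuousV _ _ (fun x : R => 1 - x) x).
  by rewrite subr_eq0 gt_eqF// (le_lt_trans xb).
by apply: cvgB; [exact: cvg_cst|exact: cvg_id].
Qed.

Lemma continuous_on_A_ladder e w : 0 < e ->
  continuous_on_co e (A_forest e (ladder w)).
Proof.
move=> e0; elim: w => [|a w IH].
  have -> : A_forest e (ladder [::]) = fun=> 1.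
    by apply/funext => z; rewrite A_ladder_nil.
  exact: continuous_on_cst.
have -> : A_forest e (ladder (a :: w)) =
    primitive e (fun t => sigma a t * A_forest e (ladder w) t).
  by apply/funext => z; rewrite A_ladder_cons.
by apply: continuous_on_primitive; apply: continuous_on_mul => //;
  exact: continuous_on_sigma.
Qed.

(** Linearity of the outermost integration. *)
Lemma sum_A_ladder_cons e a (L : seq (seq letter)) z : 0 < e -> z < 1 ->
  \sum_(w <- map (cons a) L) A_forest e (ladder w) z =
  primitive e (fun t => sigma a t * \sum_(w <- L) A_forest e (ladder w) t) z.
Proof.
move=> e0 z1; rewrite big_map; have ca := @continuous_on_sigma e a e0.
have cw w := @continuous_on_A_ladder e w e0.
elim: L => [|w L IH].
  under [X in primitive e X]eq_fun do rewrite big_nil mulr0.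
  by rewrite big_nil /primitive Rintegral_cst ?mul0r.
rewrite big_cons IH A_ladder_cons -primitiveD//; last 2 first.
- exact: continuous_on_mul.
- by apply: continuous_on_mul => //; exact: continuous_on_sum.
by congr primitive; apply/funext => t; rewrite big_cons mulrDr.
Qed.

(** The shuffle relation: integration by parts splits the product according to
    which of the two first letters carries the largest variable. *)
Lemma A_ladder_shuffle e u v z : 0 < e -> e <= z < 1 ->
  A_forest e (ladder u) z * A_forest e (ladder v) z =
  \sum_(w <- shuffle u v) A_forest e (ladder w) z.
Proof.
move=> e0; elim: u v z => [|a u IHu] v z; first by rewrite big_seq1 A_ladder_nil mul1r.
elim: v z => [|b v IHv] z; first by rewrite big_seq1 A_ladder_nil mulr1.
move=> /andP[ez z1]; rewrite shuffle_cons big_cat/= !sum_A_ladder_cons//.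
have cw c w : continuous_on_co e (fun t => sigma c t * A_forest e (ladder w) t).
  by apply: continuous_on_mul; [exact: continuous_on_sigma|exact: continuous_on_A_ladder].
rewrite !A_ladder_cons primitiveM ?ez//; congr (_ + _).
  apply: eq_primitive => x /andP[ex xz].
  by rewrite -A_ladder_cons -mulrA IHu// ex (le_lt_trans xz).
apply: eq_primitive => x /andP[ex xz].
by rewrite -A_ladder_cons -mulrA [_ * A_forest e (ladder (a :: u)) _]mulrC IHv// ex (le_lt_trans xz).
Qed.

(** Stated relatively to the trees of s, as the inductive step for
    [A_tree_words]. *)
Lemma A_trees_words e s z : 0 < e -> e <= z < 1 ->
  (forall t, t \in s -> A_tree e t z = \sum_(w <- tree_words t) A_forest e (ladder w) z) ->
  \prod_(t <- s) A_tree e t z = \sum_(w <- trees_words s) A_forest e (ladder w) z.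
Proof.
move=> e0 ez; elim: s => [_|t s IHs IH]; first by rewrite big_nil big_seq1 A_ladder_nil.
rewrite big_cons IHs => [|t' t's]; last by rewrite IH// in_cons t's orbT.
rewrite IH ?mem_head//= /shuffle_product big_flatten big_allpairs_dep mulr_suml.
apply: eq_bigr => u _; rewrite mulr_sumr; apply: eq_bigr => v _.
exact: A_ladder_shuffle.
Qed.

Lemma A_tree_words e t z : 0 < e -> e <= z < 1 ->
  A_tree e t z = \sum_(w <- tree_words t) A_forest e (ladder w) z.
Proof.
move=> e0; elim/ptree_mem_ind: t z => a s IH z /andP[ez z1].
rewrite A_treeE tree_wordsE sum_A_ladder_cons//.
apply: eq_primitive => x /andP[ex xz]; congr (_ * _).
have x1 : e <= x < 1 by rewrite ex (le_lt_trans xz).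
by apply: A_trees_words => // t ts; exact: IH.
Qed.

Definition forest_words (F : forest letter) : seq (seq letter) :=
  trees_words [seq repr t | t <- components F].

Lemma A_forest_words e F z : 0 < e -> e <= z < 1 ->
  A_forest e F z = \sum_(w <- forest_words F) A_forest e (ladder w) z.
Proof.
move=> e0 ez; rewrite -A_trees_words => // [|t _]; first by rewrite big_map.
exact: A_tree_words.
Qed.

End A_ladder.

(** * Monotonicity and bounds for iterated integrals *)

Section bounds.
Variable R : realType.
Implicit Types (e z : R) (w : seq letter) (f g F G : R -> R).

(** Bounding an integral by any function whose derivative dominates the
    integrand spares an explicit computation of integrals. *)
Lemma primitive_le e f G g z : continuous_on_co e f -> e <= z < 1 ->
  {within `[e, z], continuous G} ->
  (forall x, e < x < z -> is_derive x 1 G (g x)) ->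
  (forall x, e < x < z -> f x <= g x) -> 0 <= G e ->
  primitive e f z <= G z.
Proof.
move=> cf /andP[ez z1] cG dG fg Ge.
have dF x : e < x < z -> is_derive x 1 (primitive e f) (f x).
  by move=> /andP[ex xz]; apply: is_derive_primitive => //; exact: lt_trans z1.
have := increment_le_of_derive_le ez (continuous_on_primitive cf z1) cG dF dG fg.
rewrite primitive_start; lra.
Qed.

Lemma primitive_nondecreasing e f z z' : continuous_on_co e f ->
  (forall x, e < x < 1 -> 0 <= f x) -> e <= z -> z <= z' -> z' < 1 ->
  primitive e f z <= primitive e f z'.
Proof.
move=> cf f0 ez zz' z'1; rewrite -subr_ge0.
have := @increment_le_of_derive_le _ (fun=> 0) (primitive e f) (fun=> 0) f z z' zz'.
rewrite subrr; apply.
- by move=> x; exact: cst_continuous.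
- apply: continuous_subspaceW (continuous_on_primitive cf z'1).
  by apply: subset_itvr; rewrite bnd_simp.
- move=> x /andP[zx xz']; apply: is_derive_primitive => //.
    exact: le_lt_trans zx.
  exact: lt_trans z'1.
- by move=> x /andP[zx xz']; apply: f0; rewrite (le_lt_trans ez)//= (lt_trans xz').
Qed.

Lemma sigma_ge0 a (x : R) : 0 < x < 1 -> 0 <= sigma a x.
Proof. by case: a => /andP[x0 x1] /=; rewrite invr_ge0 ?subr_ge0 ltW. Qed.

Lemma A_ladder_ge0 e w z : 0 < e -> z < 1 -> 0 <= A_forest e (ladder w) z.
Proof.
move=> e0; elim: w z => [|a w IH] z z1; first by rewrite A_ladder_nil.
rewrite A_ladder_cons; apply: Rintegral_ge0 => x /=; rewrite in_itv/=.
move=> /andP[ex xz]; have x1 := le_lt_trans xz z1.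
by rewrite mulr_ge0 ?IH// sigma_ge0// x1 (lt_le_trans e0).
Qed.

Lemma continuous_on_integrand e a w : 0 < e ->
  continuous_on_co e (fun t => sigma a t * A_forest e (ladder w) t).
Proof.
by move=> e0; apply: continuous_on_mul;
  [exact: continuous_on_sigma|exact: continuous_on_A_ladder].
Qed.

Lemma A_ladder_nondecreasing e w z z' : 0 < e -> e <= z -> z <= z' -> z' < 1 ->
  A_forest e (ladder w) z <= A_forest e (ladder w) z'.
Proof.
move=> e0; case: w => [|a w] ez zz' z'1; first by rewrite !A_ladder_nil.
rewrite !A_ladder_cons; apply: primitive_nondecreasing => //.
  exact: continuous_on_integrand.
move=> x /andP[ex x1].
by rewrite mulr_ge0 ?A_ladder_ge0// sigma_ge0// x1 (lt_trans e0).
Qed.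

(** Lowering the starting point enlarges the domain of integration of a
    nonnegative integrand. *)
Lemma A_ladder_antitone e e' w z : 0 < e' -> e' <= e -> e <= z < 1 ->
  A_forest e (ladder w) z <= A_forest e' (ladder w) z.
Proof.
move=> e'0 e'e; have e0 := lt_le_trans e'0 e'e.
elim: w z => [|a w IH] z /andP[ez z1]; first by rewrite !A_ladder_nil.
rewrite !A_ladder_cons.
have cf := @continuous_on_integrand e' a w e'0.
apply: (@primitive_le _ _ _ (fun t => sigma a t * A_forest e' (ladder w) t)).
- exact: continuous_on_integrand.
- by rewrite ez.
- apply: continuous_subspaceW (continuous_on_primitive cf z1).
  by apply: subset_itvr; rewrite bnd_simp.
- move=> x /andP[ex xz]; apply: is_derive_primitive => //.
    exact: le_lt_trans ex.
  exact: lt_trans z1.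
- move=> x /andP[ex xz]; have x1 := lt_trans xz z1.
  rewrite ler_wpM2l ?IH ?(ltW ex)//.
  by rewrite sigma_ge0// x1 (lt_trans e0).
- by rewrite -A_ladder_cons A_ladder_ge0// (le_lt_trans ez).
Qed.

Lemma is_derive_sqrt_sub1 (x : R) : x < 1 ->
  is_derive x 1 (fun t => Num.sqrt (1 - t)) (- (2 * Num.sqrt (1 - x))^-1).
Proof.
move=> x1.
have d1 : is_derive x 1 (fun t : R => 1 - t) (0 - 1).
  by apply: is_deriveB.
have d2 : is_derive (1 - x) 1 Num.sqrt (2 * Num.sqrt (1 - x))^-1.
  by apply: is_derive1_sqrt; rewrite subr_gt0.
have := @is_derive1_comp _ Num.sqrt (fun t => 1 - t) x _ _ d2 d1.
by rewrite sub0r mulrN1.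
Qed.

Lemma sqrt_sub1 (x : R) : 0 < x < 1 -> let s := Num.sqrt (1 - x) in
  [/\ 0 < s, s < 1 & s ^+ 2 = 1 - x].
Proof.
move=> /andP[x0 x1] s.
have s0 : 0 < s by rewrite sqrtr_gt0 subr_gt0.
have s2 : s ^+ 2 = 1 - x by rewrite sqr_sqrtr// subr_ge0 ltW.
by split => //; nra.
Qed.

Lemma continuous_of_derive F f (a b : R) :
  (forall x : R, x < 1 -> is_derive x 1 F (f x)) -> b < 1 ->
  {within `[a, b], continuous F}.
Proof.
move=> dF b1; apply: derivable_within_continuous => x; rewrite in_itv/=.
by move=> /andP[_ xb]; have [] := dF x (le_lt_trans xb b1).
Qed.

(** For 0 < x < 1 this is x / sqrt (1 - x). The factor x absorbs the pole of
    sigma_x at 0; the exponent 1/2 is integrable at 1 but grows faster than the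
    powers of the logarithm that integration against sigma_y produces. *)
Definition majorant (x : R) := (Num.sqrt (1 - x))^-1 - Num.sqrt (1 - x).

Lemma is_derive_majorant (k x : R) : x < 1 ->
  is_derive x 1 (fun t => k * majorant t)
   (k * ((Num.sqrt (1 - x) ^- 2 + 1) / (2 * Num.sqrt (1 - x)))).
Proof.
move=> x1; have ds := is_derive_sqrt_sub1 x1.
have s0 : Num.sqrt (1 - x) != 0 by rewrite gt_eqF// sqrtr_gt0 subr_gt0.
have dV := @is_deriveV _ (fun t => Num.sqrt (1 - t)) x _ _ s0 ds.
have := is_deriveZ k (is_deriveB dV ds).
set d := (X in is_derive _ _ _ X); set d' := (X in _ -> is_derive _ _ _ X).
suff -> : d = d' by [].
rewrite /d /d' /GRing.scale/=; congr (_ * _); field.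
exact: s0.
Qed.

Lemma majorant_ge0 (x : R) : 0 < x < 1 -> 0 <= majorant x.
Proof.
move=> /sqrt_sub1[s0 s1 _]; rewrite /majorant subr_ge0.
by rewrite (le_trans (ltW s1))// invf_ge1// ltW.
Qed.

Lemma sigma_x_majorant (x : R) : 0 < x < 1 ->
  sigma lx x * majorant x = (Num.sqrt (1 - x))^-1.
Proof.
move=> x01; have [s0 s1 s2] := sqrt_sub1 x01; rewrite /majorant /=.
move: s0 s2; set s := Num.sqrt (1 - x) => s0 s2.
have x0 : x != 0 by case/andP: x01 => /gt_eqF->.
apply: (mulfI x0); rewrite mulVKf//; have -> : x = 1 - s ^+ 2 by rewrite s2 subKr.
by field; rewrite gt_eqF.
Qed.

(** The right-hand side is twice the derivative of [majorant]: each integration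
    costs a factor 2. *)
Lemma sigma_majorant_le a (x : R) : 0 < x < 1 ->
  sigma a x * majorant x <= (Num.sqrt (1 - x) ^- 2 + 1) / Num.sqrt (1 - x).
Proof.
move=> x01; have [s0 s1 s2] := sqrt_sub1 x01.
case: a; first rewrite sigma_x_majorant//.
  by rewrite ler_peMl ?invr_ge0 ?(ltW s0)// lerDr invr_ge0 exprn_ge0// ltW.
move: s0 s1 s2; rewrite /majorant /=; set s := Num.sqrt (1 - x) => s0 s1 <-.
rewrite mulrDl mul1r mulrBr lerD2l expr2 invfM -mulrA mulVf ?gt_eqF//.
by rewrite mulr1 (@le_trans _ _ 0)// ?oppr_le0 invr_ge0 ltW.
Qed.

(** The base case is the one-letter word y, where 1 / (1 - x) is itself at most
    twice the derivative of [majorant]; here the last letter matters, since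
    1 / x is not integrable at 0. *)
Lemma A_ladder_le_majorant e w z : 0 < e -> e <= z < 1 -> w != [::] ->
  last ly w == ly ->
  A_forest e (ladder w) z <= 2 ^+ size w * majorant z.
Proof.
move=> e0; elim: w z => [//|a w IH] z /andP[ez z1] _ wy.
rewrite A_ladder_cons.
apply: (@primitive_le _ _ (fun t => 2 ^+ size (a :: w) * majorant t)
  (fun x => 2 ^+ size (a :: w) * ((Num.sqrt (1 - x) ^- 2 + 1) / (2 * Num.sqrt (1 - x))))).
- exact: continuous_on_integrand.
- by rewrite ez.
- by apply: continuous_of_derive => // x; exact: is_derive_majorant.
- by move=> x /andP[_ xz]; apply: is_derive_majorant; exact: lt_trans z1.
- move=> x /andP[ex xz]; have x1 := lt_trans xz z1.
  have x01 : 0 < x < 1 by rewrite x1 (lt_trans e0).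
  have [s0 s1 s2] := sqrt_sub1 x01.
  have -> : (Num.sqrt (1 - x) ^- 2 + 1) / (2 * Num.sqrt (1 - x)) =
      2^-1 * ((Num.sqrt (1 - x) ^- 2 + 1) / Num.sqrt (1 - x)).
    by field; rewrite gt_eqF.
  rewrite [size (a :: w)]/= exprSr -mulrA mulVKf ?pnatr_eq0//.
  have [w_nil|w0] := eqVneq w [::].
    rewrite w_nil /= in wy *; rewrite A_ladder_nil (eqP wy) /= mulr1 mul1r.
    move: s0 s1 s2; set s := Num.sqrt (1 - x) => s0 s1 <-.
    rewrite -[X in X <= _]mulr1 ler_pM ?invr_ge0 ?exprn_ge0 ?(ltW s0) ?lerDl//.
    by rewrite invf_ge1 // ltW.
  have wy' : last ly w == ly by move: wy w0; case: (w).
  have := IH x _ w0 wy'; rewrite (ltW ex) x1 => /(_ isT) IHx.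
  rewrite (le_trans (ler_wpM2l (sigma_ge0 a x01) IHx))//.
  by rewrite mulrCA ler_wpM2l// sigma_majorant_le.
- by rewrite mulr_ge0// majorant_ge0// e0 (le_lt_trans ez).
Qed.

(** The outermost x turns the majorant into 1 / sqrt (1 - x), a primitive of
    which is bounded up to 1. *)
Lemma A_ladder_x_le e w z : 0 < e -> e <= z < 1 -> w != [::] ->
  last ly w == ly ->
  A_forest e (ladder (lx :: w)) z <= 2 ^+ (size w).+1.
Proof.
move=> e0 /andP[ez z1] w0 wy.
have d1 (x : R) : x < 1 -> is_derive x 1 (fun t => 2 ^+ (size w).+1 * (1 - Num.sqrt (1 - t)))
   (2 ^+ size w / Num.sqrt (1 - x)).
  move=> x1; have ds := is_derive_sqrt_sub1 x1.
  have s0 : Num.sqrt (1 - x) != 0 by rewrite gt_eqF// sqrtr_gt0 subr_gt0.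
  have := is_deriveZ (2 ^+ (size w).+1) (is_deriveB (is_derive_cst (1 : R) x 1) ds).
  set d := (X in is_derive _ _ _ X); set d' := (X in _ -> is_derive _ _ _ X).
  suff -> : d = d' by [].
  rewrite /d /d' /GRing.scale/= exprS; field.
  exact: s0.
have zs := @sqrtr_ge0 R (1 - z).
apply: (@le_trans _ _ (2 ^+ (size w).+1 * (1 - Num.sqrt (1 - z)))); last first.
  by rewrite ler_piMr// lerBlDr lerDl.
rewrite A_ladder_cons.
apply: (@primitive_le _ _ (fun t => 2 ^+ (size w).+1 * (1 - Num.sqrt (1 - t))) (fun x => 2 ^+ size w / Num.sqrt (1 - x))).
- exact: continuous_on_integrand.
- by rewrite ez.
- exact: continuous_of_derive z1.
- by move=> x /andP[_ xz]; apply: d1; exact: lt_trans z1.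
- move=> x /andP[ex xz]; have x1 := lt_trans xz z1.
  have x01 : 0 < x < 1 by rewrite x1 (lt_trans e0).
  have [s0 s1 s2] := sqrt_sub1 x01.
  have xA : A_forest e (ladder w) x <= 2 ^+ size w * majorant x.
    by apply: A_ladder_le_majorant => //; rewrite (ltW ex).
  rewrite (le_trans (ler_wpM2l (sigma_ge0 lx x01) xA))//.
  by rewrite mulrCA sigma_x_majorant.
- have [|_ s1 _] := @sqrt_sub1 e; first by rewrite e0 (le_lt_trans ez).
  by rewrite mulr_ge0// subr_ge0 ltW.
Qed.

End bounds.

(** * Limits *)

Section limits.
Variable R : realType.
Implicit Types (e z : R) (w : seq letter) (F G : forest letter).

Lemma semiconvergent_words F : semiconvergent F ->
  all (fun w => last ly w == ly) (forest_words F).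
Proof.
move=> /allP sF; apply: last_trees_words; rewrite all_map; apply/allP => t tF /=.
apply: last_tree_words; move: (sF t tF) => /=; apply: sub_all => v /=.
by case: is_leaf.
Qed.

Lemma convergent_words F : convergent F -> all convergent_word (forest_words F).
Proof.
move=> /andP[/semiconvergent_words/allP lastF rootF].
have /allP headF : all (fun w => head lx w == lx) (forest_words F).
  by apply: head_trees_words; rewrite all_map.
apply/allP => w wF; have := lastF w wF; have := headF w wF.
by rewrite /convergent_word; case: w {wF} => //= a w -> ->.
Qed.

(** The iterated integrals increase and stay bounded as e decreases to 0. *)
Lemma A_ladder_cvg w z : last ly w == ly -> 0 < z < 1 ->
  cvg (A_forest e (ladder w) z @[e --> (0 : R)^'+]).
Proof.
move=> wy /andP[z0 z1]; apply: nonincreasing_at_right_is_cvgr; near=> x.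
  move=> e e'; rewrite !in_itv/= => /andP[e0 ex] /andP[e'0 e'x] ee'.
  apply: A_ladder_antitone => //; rewrite z1 andbT.
  by apply/ltW/(lt_trans e'x); near: x; exact: nbhs_right_lt.
exists (Num.max 1 (2 ^+ size w * majorant z)) => _ [e /= + <-].
rewrite in_itv/= => /andP[e0 ex]; rewrite le_max.
have [->|w0] := eqVneq w [::]; first by rewrite A_ladder_nil lexx.
rewrite A_ladder_le_majorant ?orbT// z1 andbT.
by apply/ltW/(lt_trans ex); near: x; exact: nbhs_right_lt.
Unshelve. all: by end_near. Qed.

(** Monotone in z; for a nonempty word, bounded uniformly in z because the word
    starts with x. *)
Lemma Li_ladder_cvg w : convergent_word w ->
  cvg (Li_forest (ladder w) z @[z --> (1 : R)^'-]).
Proof.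
move=> /orP[/eqP->|].
  apply/cvg_ex; exists 1; apply: cvg_near_cst; near=> z; apply/cvg_lim => //.
  under eq_fun do rewrite A_ladder_nil.
  exact: cvg_cst.
case: w => [/andP[/eqP//]|a [|b w]] /= /andP[/eqP->]; first by move=> /eqP.
move=> wy.
have cLi z : 0 < z < 1 ->
    cvg (A_forest e (ladder [:: lx, b & w]) z @[e --> (0 : R)^'+]).
  exact: A_ladder_cvg.
apply: nondecreasing_at_left_is_cvgr; near=> x.
  have x0 : 0 < x by near: x; apply: nbhs_left_gt.
  move=> z z'; rewrite !in_itv/= => /andP[xz z1] /andP[xz' z'1] zz'.
  apply: ler_lim.
  - by apply: cLi; rewrite z1 (lt_trans x0).
  - by apply: cLi; rewrite z'1 (lt_trans x0).
  near=> e; apply: (@A_ladder_nondecreasing _ e [:: lx, b & w]) => //.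
  by near: e; apply: nbhs_right_le; exact: lt_trans xz.
have x0 : 0 < x by near: x; apply: nbhs_left_gt.
exists (2 ^+ (size (b :: w)).+1) => _ [z /= + <-].
rewrite in_itv/= => /andP[xz z1]; have z0 := lt_trans x0 xz.
apply: limr_le; first by apply: cLi; rewrite z0.
near=> e; apply: (@A_ladder_x_le _ e (b :: w)) => //.
rewrite z1 andbT; near: e; exact: nbhs_right_le.
Unshelve. all: by end_near. Qed.

Lemma cvg_sum_seq (I : eqType) (U : Type) (Fi : set_system U) {FF : Filter Fi}
    (s : seq I) (f : I -> U -> R) (l : I -> R) :
  (forall i, i \in s -> f i x @[x --> Fi] --> l i) ->
  \sum_(i <- s) f i x @[x --> Fi] --> \sum_(i <- s) l i.
Proof.
move=> fl; rewrite big_seq; under eq_cvg do rewrite big_seq.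
by apply: cvg_big; [exact: add_continuous|exact: fl].
Qed.

Lemma A_forest_cvg F z : semiconvergent F -> 0 < z < 1 ->
  A_forest e F z @[e --> (0 : R)^'+] -->
  \sum_(w <- forest_words F) Li_forest (ladder w) z.
Proof.
move=> /semiconvergent_words/allP sF z01; have /andP[z0 z1] := z01.
have : \sum_(w <- forest_words F) A_forest e (ladder w) z @[e --> (0 : R)^'+]
    --> \sum_(w <- forest_words F) Li_forest (ladder w) z.
  by apply: cvg_sum_seq => w wF; apply: A_ladder_cvg => //; exact: sF.
apply: cvg_trans; apply: near_eq_cvg; near=> e.
rewrite -A_forest_words// z1 andbT.
by near: e; exact: nbhs_right_le.
Unshelve. all: by end_near. Qed.

Lemma Li_forest_words F z : semiconvergent F -> 0 < z < 1 ->
  Li_forest F z = \sum_(w <- forest_words F) Li_forest (ladder w) z.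
Proof. by move=> sF z01; apply/cvg_lim => //; exact: A_forest_cvg. Qed.

Lemma Li_forest_cvg F : convergent F ->
  Li_forest F z @[z --> (1 : R)^'-] --> \sum_(w <- forest_words F) zeta_word R w.
Proof.
move=> cF; have /andP[sF _] := cF; have /allP wF := convergent_words cF.
have : \sum_(w <- forest_words F) Li_forest (ladder w) z @[z --> (1 : R)^'-]
    --> \sum_(w <- forest_words F) zeta_word R w.
  by apply: cvg_sum_seq => w /wF; exact: Li_ladder_cvg.
apply: cvg_trans; apply: near_eq_cvg; near=> z.
rewrite -Li_forest_words//; apply/andP; split; near: z.
  exact: nbhs_left_gt.
exact: nbhs_left_lt.
Unshelve. all: by end_near. Qed.

Lemma zeta_forest_words F : convergent F ->
  zeta_forest R F = \sum_(w <- forest_words F) zeta_word R w.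
Proof. by move=> cF; apply/cvg_lim => //; exact: Li_forest_cvg. Qed.

Lemma zeta_forest_empty : zeta_forest R mone = 1.
Proof.
rewrite (zeta_forest_words convergent_empty) /forest_words components_empty.
rewrite big_seq1; apply/cvg_lim => //; apply: cvg_near_cst; near=> z.
apply/cvg_lim => //; under eq_fun do rewrite A_ladder_nil.
exact: cvg_cst.
Unshelve. all: by end_near. Qed.

(** A product of limits, valid because both limits exist. *)
Lemma Li_forest_mul F G z : semiconvergent F -> semiconvergent G -> 0 < z < 1 ->
  Li_forest (mmul F G) z = Li_forest F z * Li_forest G z.
Proof.
move=> sF sG z01; apply/cvg_lim => //; under eq_fun do rewrite A_forest_mul.
by rewrite !Li_forest_words//; apply: cvgM; exact: A_forest_cvg.
Qed.

Lemma zeta_forest_mul F G : convergent F -> convergent G ->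
  zeta_forest R (mmul F G) = zeta_forest R F * zeta_forest R G.
Proof.
move=> cF cG; have /andP[sF _] := cF; have /andP[sG _] := cG.
apply/cvg_lim => //.
have : Li_forest F z * Li_forest G z @[z --> (1 : R)^'-] -->
    zeta_forest R F * zeta_forest R G.
  by apply: cvgM; rewrite zeta_forest_words//; exact: Li_forest_cvg.
apply: cvg_trans; apply: near_eq_cvg; near=> z.
rewrite Li_forest_mul//; apply/andP; split; near: z.
  exact: nbhs_left_gt.
exact: nbhs_left_lt.
Unshelve. all: by end_near. Qed.

End limits.

(** * The linear extension *)

Section linear_extension.
Variable R : realType.

(** The same linear extension on the whole algebra of forests, where the basis
    elements and the sums of the proof live. *)
Definition zeta_alg : forest_alg R letter -> R := mmap idfun (zeta_forest R).

Lemma zeta_algU F : zeta_alg << F >> = zeta_forest R F.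
Proof. by rewrite /zeta_alg mmapU mul1r. Qed.

Lemma zeta_alg_sum (I : Type) (s : seq I) (u : I -> forest_alg R letter) :
  zeta_alg (\sum_(i <- s) u i) = \sum_(i <- s) zeta_alg (u i).
Proof. exact: (raddf_sum (mmap idfun (zeta_forest R))). Qed.

Lemma zeta_algD u v : zeta_alg (u + v) = zeta_alg u + zeta_alg v.
Proof. exact: (raddfD (mmap idfun (zeta_forest R))). Qed.

Lemma zeta_algZ (a : R) u : zeta_alg (a *: u) = a * zeta_alg u.
Proof.
rewrite /zeta_alg (mmapEw (d := msupp u)); last exact: msuppZ_le.
by rewrite mmapE mulr_sumr; apply: eq_bigr => F _; rewrite mcoeffZ mulrA.
Qed.

Lemma zeta_algZU (a : R) F : zeta_alg (a *: << F >>) = a * zeta_forest R F.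
Proof. by rewrite zeta_algZ zeta_algU. Qed.

Lemma zeta_convE (u : conv_alg R) : zeta_conv u = zeta_alg (val u).
Proof. by []. Qed.

Lemma forest_alg_mulU (a b : R) F G :
  (a *: << F >>) * (b *: << G >>) = (a * b) *: << mmul F G >> :> forest_alg R letter.
Proof.
rewrite -[LHS]scalerAl -[in LHS]scalerAr scalerA; congr (_ *: _).
by rewrite /GRing.mul/= fgmulUU mulr1.
Qed.

(** By bilinearity, multiplicativity on convergent forests suffices. *)
Lemma zeta_alg_mul u v : u \in @conv_span R -> v \in @conv_span R ->
  zeta_alg (u * v) = zeta_alg u * zeta_alg v.
Proof.
move=> /asboolP[s cs ->] /asboolP[s' cs' ->].
rewrite mulr_suml !zeta_alg_sum mulr_suml [LHS]big_seq [RHS]big_seq.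
apply: eq_bigr => p ps.
rewrite mulr_sumr zeta_alg_sum mulr_sumr [LHS]big_seq [RHS]big_seq.
apply: eq_bigr => q qs.
rewrite (forest_alg_mulU p.1 q.1 p.2 q.2).
rewrite [LHS]zeta_algZU zeta_forest_mul.
- by rewrite mulrACA; congr (_ * _); rewrite zeta_algZU.
- by apply: (allP cs); exact: map_f.
- by apply: (allP cs'); exact: map_f.
Qed.

End linear_extension.

Theorem theorem3 (R : realType) :
  (forall F : forest letter, convergent F ->
     (exists2 s : seq (rat * seq letter),
        all convergent_word (map snd s) &
        zeta_forest R F = \sum_(p <- s) ratr p.1 * zeta_word R p.2) /\
     (exists2 s : seq (int * seq letter),
        all convergent_word (map snd s) &
        zeta_forest R F = \sum_(p <- s) p.1%:~R * zeta_word R p.2)) /\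
  (scalar (@zeta_conv R) /\ GRing.monoid_morphism (@zeta_conv R)).
Proof.
split=> [F cF|].
  have cw := convergent_words cF; have zF := zeta_forest_words R cF.
  split.
    exists [seq (1, w) | w <- forest_words F].
      by rewrite -map_comp map_id.
    by rewrite big_map zF; apply: eq_bigr => w _; rewrite rmorph1 mul1r.
  exists [seq (1, w) | w <- forest_words F].
    by rewrite -map_comp map_id.
  by rewrite big_map zF; apply: eq_bigr => w _; rewrite rmorph1 mul1r.
split.
  move=> a u v; rewrite !zeta_convE.
  have -> : val (a *: u + v) = a *: val u + val v by rewrite linearP.
  by rewrite zeta_algD zeta_algZ.
split.
  have -> : zeta_conv (1 : conv_alg R) = zeta_alg << mone >> by [].
  by rewrite zeta_algU zeta_forest_empty.
by move=> u v; rewrite !zeta_convE rmorphM; apply: zeta_alg_mul; exact: valP.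
Qed.
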